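(* Let $d\ge1$ and let $f(t,x)$ be the height function of an RSOS surface on $\mathbb{Z}^d$ with initial condition $f(0,x)=H(x)$, $x\in\mathbb{Z}^d$, where $H:\mathbb{Z}^d\to\mathbb{Z}$ satisfies $|H(x)-H(y)|\le 1$ for all nearest neighbours $x,y$. Then (almost surely, for all $t\ge 0$ and $x\in\mathbb{Z}^d$) $$f(t,x)=\min_{\gamma\in\Gamma_{t,x}}\left[W(\gamma)+H(\gamma(0))\right].$$
   Context: Let $\mathcal{N}=\{\pm e_i\}_{i=1}^d$ and $\mathcal{N}_0=\mathcal{N}\cup\{0\}$. Independent rate-$1$ Poisson clocks are attached to the sites of $\mathbb{Z}^d$; the set of rings $\mathcal{U}\subset\mathbb{R}_+\times\mathbb{Z}^d$ is a Poisson point process whose points $(t,x)$ are called updates. RSOS (Restricted Solid-on-Solid) model: the height $f:\mathbb{R}_+\times\mathbb{Z}^d\to\mathbb{Z}$ is right-continuous in time; the height at $x$ can only change when the clock at $x$ rings, and at an update $(t,x)\in\mathcal{U}$, $$f(t,x)=f(t^-,x)+\prod_{n\in\mathcal{N}}\mathbf{1}\{f(t^-,x)\le f(t^-,x+n)\},$$ where $t^-$ denotes the left limit in time. The process is almost surely well defined. Lattice path: a lattice path ending at $(t,x)$ is a right-continuous, piecewise constant function $\gamma:[0,t]\to\mathbb{Z}^d$ with $\gamma(t)=x$ that changes value at a time $s$ only when $(s,\gamma(s))$ is an update, in which case $\gamma(s)=\gamma(s^-)+n$ for some $n\in\mathcal{N}_0$. A space-time point $(s,y)$ belongs to $\gamma$,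 written $(s,y)\in\gamma$, if $\gamma(s)=y$. $\Gamma_{t,x}$ is the set of lattice paths starting at time $0$ (at any site) and ending at $(t,x)$. The weight $W(\gamma)$ is the number of updates $(u_t,u_x)\in\mathcal{U}$ with $u_t>0$ and $(u_t,u_x)\in\gamma$. *)

(* Defs.v *)
From HB Require Import structures.
From mathcomp Require Import all_boot all_order all_algebra.
From mathcomp Require Import all_classical all_reals all_analysis.
From mathcomp Require Import measurable_realfun.

Set Implicit Arguments.
Unset Strict Implicit.
Unset Printing Implicit Defensive.

Import Order.TTheory GRing.Theory Num.Theory.
Import numFieldNormedType.Exports.

Local Open Scope classical_set_scope.
Local Open Scope ring_scope.

Notation lattice d := 'rV[int]_d.

Definition nbrs (d : nat) : seq (lattice d) :=
  [seq delta_mx 0 i | i <- enum 'I_d] ++ [seq - delta_mx 0 i | i <- enum 'I_d].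

Definition nbrs0 (d : nat) : seq (lattice d) := 0 :: nbrs d.

(* Left limit of a function with values in a discrete set. When the limit does
   not exist the value is the irrelevant default [g t]. *)
Definition left_lim (R : realType) (E : choiceType) (g : R -> E) (t : R) : E :=
  xget (g t) [set l | \forall u \near t^'-, g u = l].

Definition right_continuous_at (R : realType) (E : Type) (g : R -> E) (t : R) :=
  \forall u \near t^'+, g u = g t.

(* As the lattice is countable and discrete, a set of space-time points is
   Borel iff all its time sections are, and its measure for the product of
   Lebesgue measure on R_+ and counting measure is the sum over the sections. *)
Definition time_section (R : realType) (d : nat) (B : set (R * lattice d))
  (x : lattice d) : set R := [set t | B (t, x)].

Definition spacetime_borel (R : realType) (d : nat) (B : set (R * lattice d)) :=
  forall x, measurable (time_section B x).

Definition intensity (R : realType) (d : nat) (B : set (R * lattice d)) : \bar R :=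
  (\esum_(x in [set: lattice d])
     lebesgue_measure (time_section B x `&` `[0%R, +oo[))%E.

Definition mutually_independent (R : realType) (disp : measure_display)
    (T : measurableType disp) (P : probability T R) (n : nat)
    (X : 'I_n -> T -> \bar R) : Prop :=
  forall A : 'I_n -> set (\bar R), (forall i, measurable (A i)) ->
    P (\bigcap_(i in [set: 'I_n]) (X i @^-1` A i)) =
    (\prod_(i < n) P (X i @^-1` A i))%E.

Definition num_points (R : realType) (T : Type) (d : nat)
    (U : T -> set (R * lattice d)) (B : set (R * lattice d)) (w : T) : \bar R :=
  counting (U w `&` B).

(* The Poisson weights are written out because the library's [poisson_pmf] is
   the constant 1, not a Dirac mass at 0, when the parameter is 0. *)
Record poisson_clocks (R : realType) (disp : measure_display)
    (T : measurableType disp) (P : probability T R) (d : nat)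
    (U : T -> set (R * lattice d)) : Prop := {
  clocks_time_ge0 : forall w p, U w p -> 0 <= p.1;
  clocks_measurable : forall B, spacetime_borel B ->
    measurable_fun [set: T] (num_points U B);
  clocks_poisson : forall B (lambda : R), spacetime_borel B ->
    intensity B = lambda%:E -> forall k : nat,
    P (num_points U B @^-1` [set k%:R%:E]) =
      (lambda ^+ k / k`!%:R * expR (- lambda))%:E;
  clocks_independent : forall (n : nat) (B : 'I_n -> set (R * lattice d)),
    (forall i, spacetime_borel (B i)) -> trivIset [set: 'I_n] B ->
    mutually_independent P (fun i => num_points U (B i))
}.

Record rsos (R : realType) (d : nat) (U : set (R * lattice d))
    (H : lattice d -> int) (f : R -> lattice d -> int) : Prop := {
  rsos_init : forall x, f 0 x = H x;
  rsos_right_continuous : forall x (t : R), 0 <= t -> right_continuous_at (f ^~ x) t;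
  rsos_no_ring : forall x (s t : R), 0 <= s -> s <= t ->
    (forall u : R, s < u <= t -> ~ U (u, x)) -> f t x = f s x;
  rsos_ring : forall x (t : R), 0 < t -> U (t, x) ->
    f t x = left_lim (f ^~ x) t +
      \prod_(n <- nbrs d)
        (left_lim (f ^~ x) t <= left_lim (f ^~ (x + n)) t)%R%:R
}.

Definition piecewise_constant (R : realType) (E : Type) (t : R) (g : R -> E) :=
  exists2 s : seq R, itv_partition 0 t s &
    forall i, (i < size s)%N -> forall u v : R,
      u \in `]nth 0 (0 :: s) i, nth 0 (0 :: s) i.+1[ ->
      v \in `]nth 0 (0 :: s) i, nth 0 (0 :: s) i.+1[ -> g u = g v.

(* A path is a total function on R of which only the restriction to [0, t]
   matters. *)
Record lattice_path (R : realType) (d : nat) (U : set (R * lattice d))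
    (t : R) (x : lattice d) (g : R -> lattice d) : Prop := {
  path_end : g t = x;
  path_right_continuous : forall s : R, 0 <= s < t -> right_continuous_at g s;
  path_piecewise_constant : piecewise_constant t g;
  path_jump : forall s : R, 0 < s <= t -> g s <> left_lim g s ->
    U (s, g s) /\ exists2 n, n \in nbrs0 d & g s = left_lim g s + n
}.

Definition path_weight (R : realType) (d : nat) (U : set (R * lattice d))
    (t : R) (g : R -> lattice d) : \bar R :=
  counting [set p : R * lattice d | [/\ U p, 0 < p.1 <= t & g p.1 = p.2]].

Definition is_min (R : realType) (A : set (\bar R)) (m : \bar R) : Prop :=
  A m /\ lbound A m.

(* Main.v *)
Require Import Defs.
From HB Require Import structures.
From mathcomp Require Import all_boot all_order all_algebra.
From mathcomp Require Import all_classical all_reals all_analysis.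
From mathcomp Require Import measurable_realfun.
From mathcomp Require Import finmap lra zify.
Import Order.TTheory GRing.Theory Num.Theory.
Import numFieldNormedType.Exports.
Local Open Scope classical_set_scope.
Local Open Scope ring_scope.
Set Implicit Arguments.
Unset Strict Implicit.
Unset Printing Implicit Defensive.

(** Call [path_weight U t g + H (g 0)] the action of a path [g] ending at time
[t].  The theorem holds for a fixed realisation [w] as soon as the rings of
[w] satisfy two conditions, and both conditions hold almost surely.

No path has action below the height.  Along a path the height at its current
position grows by at most 1 at each update that it meets, and does not grow
otherwise.  A path that waits at a ring meets an increment of at most 1.  A
path that jumps from [y + n] to [y] at a ring of [y] relies on two facts: the
heights of neighbours differ by at most 1 just before the ring (this property
of [H] is propagated by the dynamics, [rsos_gradient]), and the site [y] can
only grow when its height does not exceed that of [y + n].  So the new height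
of [y] is at most 1 above the old height of [y + n] ([rsos_jump_le]).  Real
induction on time turns this into [rsos_le_path_action].

Some path has action equal to the height.  It is built backwards in time from
[(t, x)].  Between rings it stays put.  At a ring of its position [y] there is
always a site, [y] itself or a neighbour, whose height just before the ring is
one less than the height of [y] just after ([rsos_predecessor]): if [y] grew,
take [y]; if not, some neighbour was strictly lower, hence lower by exactly 1.
Moving there costs one update and loses one unit of height.

This backward construction must reach time 0 after finitely many steps, which
may fail for an exceptional set of rings.  It is here that randomness enters.
Cut time into windows of length [delta] with [2 d delta <= 1/2].  Within a
window a site rings with probability at most [delta], independently of the
others, and there are [(2 d) ^ K] walks with [K] steps from [x].  So the
probability that all sites of some self-avoiding walk with [K] steps ring is
at most [delta * 2 ^ -K], and almost surely this fails for some [K]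
([ae_no_long_ringing_walk]).  Then only finitely many sites can be reached
from [x] through sites that ring in the window ([finite_cluster]).  Together
they ring finitely often ([ae_locally_finite]), and each backward step uses up
one of these rings ([has_optimal_path_window]).  An induction over the windows
concludes. *)

(** * One-sided limits and real induction *)

Lemma near_at_leftP (R : realType) (t : R) (P : set R) :
  (\forall u \near t^'-, P u) <->
  exists2 r, r < t & forall u, r < u < t -> P u.
Proof.
split=> [|[r rt rP]].
  move=> [/= e e0 eP]; exists (t - e); first by rewrite ltrBlDr ltrDl.
  move=> u /andP[ru ut]; apply: eP => //=.
  by rewrite /ball_/= ger0_norm ?subr_ge0 ?(ltW ut)//; lra.
near=> u; apply: rP; apply/andP; split; last by near: u; exact: nbhs_left_lt.
by near: u; exact: nbhs_left_gt.
Unshelve. all: by end_near. Qed.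

Lemma near_at_rightP (R : realType) (t : R) (P : set R) :
  (\forall u \near t^'+, P u) <->
  exists2 r, t < r & forall u, t < u < r -> P u.
Proof.
split=> [|[r rt rP]].
  move=> [/= e e0 eP]; exists (t + e); first by rewrite ltrDl.
  move=> u /andP[ru ut]; apply: eP => //=.
  by rewrite /ball_/= ler0_norm ?subr_le0 ?(ltW ru)//; lra.
near=> u; apply: rP; apply/andP; split; first by near: u; exact: nbhs_right_gt.
by near: u; exact: nbhs_right_lt.
Unshelve. all: by end_near. Qed.

Lemma left_limE (R : realType) (E : choiceType) (g : R -> E) (t r : R) (l : E) :
  r < t -> (forall u, r < u < t -> g u = l) -> left_lim g t = l.
Proof.
move=> rt gl; rewrite /left_lim; apply: xget_unique.
  by apply/near_at_leftP; exists r.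
move=> y /near_at_leftP[r' r't gy].
pose m := Num.max r r'; have mt : m < t by rewrite /m gt_max rt.
have /andP[ma mb] : m < (m + t) / 2 < t by apply/andP; split; lra.
move: ma; rewrite /m gt_max => /andP[ma1 ma2].
by rewrite -(gl ((m + t) / 2)) ?ma1// gy ?ma2.
Qed.

(** The value at [t] is compared as well because it is the default of
[left_lim]. *)
Lemma eq_left_lim (R : realType) (E : choiceType) (g h : R -> E) (t : R) :
  (forall u, u <= t -> g u = h u) -> left_lim g t = left_lim h t.
Proof.
move=> gh; rewrite /left_lim gh//; congr xget; apply/seteqP.
by split=> l /= /near_at_leftP[r rt rl]; apply/near_at_leftP; exists r => // u;
  move=> /[dup] /andP[_ /ltW ut] /rl <-; rewrite gh.
Qed.

(** The induction principle behind the two estimates that are propagated forward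
in time: a property survives to the right of any time where it holds, and
passes to the limit from the left, so the supremum of the times up to which it
holds is [t]. *)
Lemma real_induction (R : realType) (t : R) (P : R -> Prop) :
  0 <= t -> P 0 ->
  (forall s, 0 <= s < t -> P s ->
    exists2 r, s < r & forall u, s < u < r -> P u) ->
  (forall s, 0 < s <= t -> (forall u, 0 <= u < s -> P u) -> P s) ->
  P t.
Proof.
move=> t0 P0 Pright Pleft.
pose A := [set s | 0 <= s <= t /\ forall u, 0 <= u <= s -> P u].
have A0 : A 0.
  split; first by rewrite lexx.
  by move=> u u0; rewrite (_ : u = 0)//; apply/eqP; rewrite eq_le andbC.
have supA : has_sup A.
  by split; [exists 0|exists t => s [/andP[]]].
have m0 : 0 <= sup A by apply: ub_le_sup => //; case: supA.
have mt : sup A <= t by apply: ge_sup => [|s [/andP[]]//]; exists 0.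
have Pm : forall u, 0 <= u <= sup A -> P u.
  have Plt u : 0 <= u < sup A -> P u.
    move=> /andP[u0 um].
    have um0 : 0 < sup A - u by rewrite subr_gt0.
    have [a [_ Aa] +] := sup_adherent um0 supA.
    by rewrite subKr => ua; apply: Aa; rewrite u0 ltW.
  move=> u /andP[u0]; rewrite le_eqVlt => /orP[/eqP um|um]; last first.
    by apply: Plt; rewrite u0.
  move: u0; rewrite le_eqVlt => /orP[/eqP<-//|u0].
  apply: Pleft; first by rewrite u0 um.
  by move=> v; rewrite um; exact: Plt.
have [tm|tm] := leP t (sup A); first by apply: Pm; rewrite t0.
have Psup : P (sup A) by apply: Pm; rewrite m0 lexx.
have mt' : 0 <= sup A < t by rewrite m0.
have [r mr Pr] := Pright _ mt' Psup.
pose s := (sup A + Num.min r t) / 2.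
have mm : sup A < Num.min r t by rewrite lt_min mr.
have [sr st] : s < r /\ s <= t.
  have h1 : s < Num.min r t by rewrite /s; lra.
  by move: h1; rewrite lt_min => /andP[-> /ltW].
have ms : sup A < s by rewrite /s; lra.
suff As : A s by have := ub_le_sup (proj2 supA) As; rewrite leNgt ms.
split; first by rewrite st (le_trans m0)// ltW.
move=> u /andP[u0 us]; have [um|mu] := leP u (sup A).
  by apply: Pm; rewrite u0.
by apply: Pr; rewrite mu (le_lt_trans us).
Qed.

(** Stated without naming a maximum because a finite set may miss [`]a, b]]. *)
Lemma finite_last (R : realType) (A : set R) (a b : R) : finite_set A ->
  (forall v, a < v <= b -> ~ A v) \/
  exists2 u, a < u <= b /\ A u & forall v, u < v <= b -> ~ A v.
Proof.
move=> /finite_seqP[s ->{A}].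
elim: s => [|e s [ih|[u [/andP[au ub] us] ulast]]]; first by left.
- have [/andP[ae eb]|eab] := boolP (a < e <= b); [right|left].
    exists e; first by rewrite ae eb/= mem_head.
    move=> v /andP[ev vb] /=; rewrite inE => /orP[/eqP ve|vs].
      by move: ev; rewrite ve ltxx.
    by apply: (ih v) => //; rewrite (lt_trans ae).
  move=> v vab /=; rewrite inE => /orP[/eqP ve|]; last exact: ih.
  by move: eab; rewrite -ve vab.
- right; have [/andP[ue eb]|eub] := boolP (u < e <= b).
    exists e; first by rewrite (lt_trans au ue) eb/= mem_head.
    move=> v /andP[ev vb] /=; rewrite inE => /orP[/eqP ve|vs].
      by move: ev; rewrite ve ltxx.
    by apply: (ulast v) => //; rewrite (lt_trans ue).
  exists u; first by rewrite au ub/= inE us orbT.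
  move=> v vub /=; rewrite inE => /orP[/eqP ve|]; last exact: ulast.
  by move: eub; rewrite -ve vub.
Qed.

(** * Rings and heights near a given time *)

Lemma nbrsN (d : nat) (n : lattice d) : n \in nbrs d -> - n \in nbrs d.
Proof.
rewrite /nbrs !mem_cat => /orP[/mapP[i _ ->]|/mapP[i _ ->]].
  by apply/orP; right; apply/mapP; exists i; rewrite ?mem_enum.
by apply/orP; left; apply/mapP; exists i; rewrite ?mem_enum ?opprK.
Qed.

Lemma nbrs0N (d : nat) (n : lattice d) : n \in nbrs0 d -> - n \in nbrs0 d.
Proof.
rewrite !inE => /orP[/eqP->|/nbrsN ->]; last by rewrite orbT.
by rewrite oppr0 eqxx.
Qed.

(** As the rings of a site do not accumulate, heights have left limits. *)
Definition locally_finite (R : realType) (d : nat) (U : set (R * lattice d)) :=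
  forall x b, finite_set [set s | 0 < s <= b /\ U (s, x)].

Lemma last_ring (R : realType) (d : nat) (U : set (R * lattice d))
    (x : lattice d) (a b : R) :
  locally_finite U -> 0 <= a ->
  (forall v, a < v <= b -> ~ U (v, x)) \/
  exists2 u, a < u <= b /\ U (u, x) & forall v, u < v <= b -> ~ U (v, x).
Proof.
move=> LF a0; have [none|[u [uab [_ Uu]] ulast]] := finite_last a b (LF x b).
  left => v /andP[av vb] Uv; apply: (none v); rewrite ?av//.
  by split=> //; rewrite vb (le_lt_trans a0).
right; exists u => // v /andP[uv vb] Uv; apply: (ulast v); rewrite ?uv//.
split=> //; rewrite vb (le_lt_trans a0)// (lt_trans _ uv)//.
by case/andP: uab.
Qed.

Lemma left_ring_free (R : realType) (d : nat) (U : set (R * lattice d))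
    (x : lattice d) (t : R) :
  locally_finite U -> 0 < t ->
  exists2 r, 0 <= r < t & forall v, r < v < t -> ~ U (v, x).
Proof.
move=> LF t0.
have fin : finite_set [set s | (0 < s <= t /\ U (s, x)) /\ s != t].
  by apply: sub_finite_set (LF x t) => s [].
have [none|[u [/andP[u0 ut] [[_ Uu] neq]] ulast]] := finite_last 0 t fin.
  exists 0; first by rewrite lexx.
  move=> v /andP[v0 vt] Uv; apply: (none v); first by rewrite v0 ltW.
  by split; [split=> //; rewrite v0 ltW|rewrite lt_eqF].
exists u; first by rewrite (ltW u0) lt_neqAle neq.
move=> v /andP[uv vt] Uv; apply: (ulast v); first by rewrite uv ltW.
by split; [split=> //; rewrite (lt_trans u0 uv) ltW|rewrite lt_eqF].
Qed.

(** A site does not ring just before [t], so its height is constant there and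
[left_lim] does not take its default value. *)
Lemma rsos_left_lim (R : realType) (d : nat) (U : set (R * lattice d))
    (H : lattice d -> int) f (x : lattice d) (t : R) :
  rsos U H f -> locally_finite U -> 0 < t ->
  exists2 r, 0 <= r < t & forall u, r <= u < t -> f u x = left_lim (f ^~ x) t.
Proof.
move=> fH LF t0; have [r /andP[r0 rt] rU] := left_ring_free x LF t0.
exists r; first by rewrite r0.
have fr u : r <= u < t -> f u x = f r x.
  move=> /andP[ru ut]; apply: (rsos_no_ring fH) => // v /andP[rv vu].
  by apply: rU; rewrite rv (le_lt_trans vu).
move=> u rut; rewrite fr//; symmetry; apply: (left_limE rt) => v /andP[rv vt].
by apply: fr; rewrite ltW.
Qed.

Lemma rsos_no_update (R : realType) (d : nat) (U : set (R * lattice d))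
    (H : lattice d -> int) f (x : lattice d) (t : R) :
  rsos U H f -> locally_finite U -> 0 < t -> ~ U (t, x) ->
  f t x = left_lim (f ^~ x) t.
Proof.
move=> fH LF t0 nU; have [r /andP[r0 rt] rU] := left_ring_free x LF t0.
have [q /andP[q0 qt] qf] := rsos_left_lim x fH LF t0.
have mt : Num.max r q < t by rewrite gt_max rt.
rewrite -(qf (Num.max r q)) ?mt ?le_max ?lexx ?orbT//.
apply: (rsos_no_ring fH); rewrite ?le_max ?r0 ?(ltW mt)//.
move=> v /andP[]; rewrite gt_max => /andP[rv qv]; rewrite le_eqVlt.
by move=> /orP[/eqP->//|vt]; apply: rU; rewrite rv.
Qed.

Lemma prod_indicator (I : eqType) (s : seq I) (p : pred I) :
  \prod_(i <- s) (p i)%:R = (all p s)%:R :> int.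
Proof.
elim: s => [|i s ih]; first by rewrite big_nil.
by rewrite big_cons ih/=; case: (p i); rewrite ?mul1r ?mul0r.
Qed.

(** One formula for rings and for times without a ring, so that case analysis on
the truth value of the indicator is enough in what follows. *)
Lemma rsos_update (R : realType) (d : nat) (U : set (R * lattice d))
    (H : lattice d -> int) f (x : lattice d) (t : R) :
  rsos U H f -> locally_finite U -> 0 < t ->
  f t x = left_lim (f ^~ x) t +
    (`[< U (t, x) >] &&
      all (fun n => left_lim (f ^~ x) t <= left_lim (f ^~ (x + n)) t)
        (nbrs d))%:R.
Proof.
move=> fH LF t0; have [Ux|nUx] := pselect (U (t, x)).
  by rewrite (rsos_ring fH)// asboolT// prod_indicator.
by rewrite asboolF// addr0; exact: (rsos_no_update fH).
Qed.

Lemma rsos_left_lim_le (R : realType) (d : nat) (U : set (R * lattice d))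
    (H : lattice d -> int) f (x : lattice d) (t : R) :
  rsos U H f -> locally_finite U -> 0 < t -> left_lim (f ^~ x) t <= f t x.
Proof. by move=> fH LF t0; rewrite (rsos_update x fH LF t0) lerDl ler0n. Qed.

(** This makes jumps of a path harmless: if [x] was already higher than [x + n]
then it does not grow, and otherwise it grows by at most 1. *)
Lemma rsos_jump_le (R : realType) (d : nat) (U : set (R * lattice d))
    (H : lattice d -> int) f (x n : lattice d) (t : R) :
  rsos U H f -> locally_finite U -> 0 < t -> n \in nbrs d ->
  left_lim (f ^~ x) t <= left_lim (f ^~ (x + n)) t + 1 ->
  f t x <= left_lim (f ^~ (x + n)) t + 1.
Proof.
move=> fH LF t0 nd grad; rewrite (rsos_update x fH LF t0).
have [/andP[_ /allP/(_ _ nd) le]|] := boolP (_ && _); last by rewrite addr0.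
by rewrite lerD2r.
Qed.

(** The restriction on gradients persists: at any time, [f t x] is at most 1
above the height of [x + n] just before [t], and that height can only increase
at [t].  This also covers simultaneous rings of [x] and [x + n]. *)
Lemma rsos_gradient (R : realType) (d : nat) (U : set (R * lattice d))
    (H : lattice d -> int) f (x n : lattice d) (t : R) :
  (forall x n, n \in nbrs d -> `|H x - H (x + n)| <= 1) ->
  rsos U H f -> locally_finite U -> 0 <= t -> n \in nbrs d ->
  f t x <= f t (x + n) + 1.
Proof.
move=> HH fH LF t0 nd.
apply: (real_induction (P := fun s => f s x <= f s (x + n) + 1)) => //.
- rewrite !(rsos_init fH); have := HH x n nd.
  by rewrite ler_norml => /andP[_]; rewrite lerBlDl.
- move=> s /andP[s0 st] fs.
  have /near_at_rightP[r sr rf] := rsos_right_continuous fH x s0.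
  have /near_at_rightP[q sq qf] := rsos_right_continuous fH (x + n) s0.
  exists (Num.min r q); first by rewrite lt_min sr.
  move=> u /andP[su]; rewrite lt_min => /andP[ur uq].
  by rewrite rf ?su// qf ?su.
- move=> s /andP[s0 st] fs.
  have [r /andP[r0 rs] rf] := rsos_left_lim x fH LF s0.
  have [q /andP[q0 qs] qf] := rsos_left_lim (x + n) fH LF s0.
  have ms : Num.max r q < s by rewrite gt_max rs.
  have := fs (Num.max r q); rewrite ms le_max r0 => /(_ isT).
  rewrite rf ?ms ?le_max ?lexx// qf ?ms ?le_max ?lexx ?orbT//.
  move=> /(rsos_jump_le fH LF s0 nd) /le_trans; apply.
  by rewrite lerD2r (rsos_left_lim_le _ fH LF).
Qed.

Lemma rsos_left_gradient (R : realType) (d : nat) (U : set (R * lattice d))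
    (H : lattice d -> int) f (x n : lattice d) (t : R) :
  (forall x n, n \in nbrs d -> `|H x - H (x + n)| <= 1) ->
  rsos U H f -> locally_finite U -> 0 < t -> n \in nbrs d ->
  left_lim (f ^~ x) t <= left_lim (f ^~ (x + n)) t + 1.
Proof.
move=> HH fH LF s0 nd.
have [r /andP[r0 rs] rf] := rsos_left_lim x fH LF s0.
have [q /andP[q0 qs] qf] := rsos_left_lim (x + n) fH LF s0.
have ms : Num.max r q < t by rewrite gt_max rs.
rewrite -(rf (Num.max r q)) ?ms ?le_max ?lexx//.
rewrite -(qf (Num.max r q)) ?ms ?le_max ?lexx ?orbT//.
by apply: (rsos_gradient _ HH fH LF); rewrite ?le_max ?r0.
Qed.

(** * The height is at most the action of any path *)

Lemma itv_partition_cell (R : realType) (a b t : R) (s : seq R) :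
  itv_partition a b s -> a < t <= b ->
  exists2 i, (i < size s)%N &
    nth 0 (a :: s) i < t <= nth 0 (a :: s) i.+1.
Proof.
elim: s a => [a /itv_partition_nil-> /andP[]|c s ih a ab /andP[at_ tb]].
  by move=> /lt_le_trans /[apply]; rewrite ltxx.
have [tc|ct] := leP t c; first by exists 0%N; rewrite //= at_.
have [|i si ti] := ih c (itv_partition_cons ab); first by rewrite ct.
by exists i.+1.
Qed.

Lemma path_left_lim (R : realType) (d : nat) (U : set (R * lattice d))
    (t : R) (x : lattice d) g (s : R) :
  lattice_path U t x g -> 0 < s <= t ->
  exists2 r, 0 <= r < s & forall u, r < u < s -> g u = left_lim g s.
Proof.
move=> gx st; have [p pt pg] := path_piecewise_constant gx.
have [i si /andP[is_ si']] := itv_partition_cell pt st.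
pose r := Num.max 0 (nth 0 (0 :: p) i).
have [s0 _] := andP st.
have rs : r < s by rewrite gt_max s0.
have gr u v : r < u < s -> r < v < s -> g u = g v.
  move=> /andP[+ us] /andP[+ vs]; rewrite !gt_max => /andP[_ iu] /andP[_ iv].
  by apply: (pg i si); rewrite in_itv/= ?iu ?iv (lt_le_trans _ si').
exists r; first by rewrite rs le_max lexx.
move=> u ru; symmetry; apply: (left_limE rs) => v rv; exact: gr.
Qed.

(** The set counted by [path_weight], which is needed as a set to compare the
weights of a path at different times and of a path with its extensions. *)
Definition path_updates (R : realType) (d : nat) (U : set (R * lattice d))
    (t : R) (g : R -> lattice d) : set (R * lattice d) :=
  [set p : R * lattice d | [/\ U p, 0 < p.1 <= t & g p.1 = p.2]].

Lemma card_fset_set_le (T : choiceType) (A B : set T) :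
  finite_set B -> A `<=` B -> (#|` fset_set A| <= #|` fset_set B|)%N.
Proof.
move=> fB AB; apply: fsubset_leq_card; rewrite -fset_set_sub//.
exact: sub_finite_set fB.
Qed.

Lemma card_fset_set_lt (T : choiceType) (A B : set T) b :
  finite_set B -> A `<=` B -> B b -> ~ A b ->
  (#|` fset_set A| < #|` fset_set B|)%N.
Proof.
move=> fB AB Bb nAb; apply: fproper_ltn_card.
have fA : finite_set A by exact: sub_finite_set fB.
rewrite fproperE; apply/andP; split; first by rewrite -fset_set_sub.
by apply/negP; rewrite -fset_set_sub// => BA; apply: nAb; exact: BA.
Qed.

(** Real induction on the time [s] up to which the path is followed, with the
number of updates met so far in the role of the weight. *)
Lemma rsos_le_path_action (R : realType) (d : nat) (U : set (R * lattice d))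
    (H : lattice d -> int) f (t : R) x g :
  (forall x n, n \in nbrs d -> `|H x - H (x + n)| <= 1) ->
  rsos U H f -> locally_finite U -> 0 <= t -> lattice_path U t x g ->
  ((f t x)%:~R%:E <= path_weight U t g + (H (g 0))%:~R%:E)%E.
Proof.
move=> HH fH LF t0 gx.
rewrite /path_weight /counting; case: asboolP => [fin|_]; last first.
  by rewrite addye// leey.
rewrite -EFinD lee_fin -[(#|` _ |)%:R]mulrz_nat -intrD ler_int natz.
rewrite -(path_end gx).
pose P s := s <= t ->
  f s (g s) <= (#|` fset_set (path_updates U s g)|)%:Z + H (g 0).
suff Pt : P t by exact: (Pt (lexx t)).
apply: real_induction => //.
- by move=> _; rewrite (rsos_init fH) lerDr.
- move=> s /andP[s0 st] fs.
  have /near_at_rightP[r sr rf] := rsos_right_continuous fH (g s) s0.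
  have /near_at_rightP[q sq qg] : right_continuous_at g s.
    by apply: (path_right_continuous gx); rewrite s0.
  exists (Num.min r q); first by rewrite lt_min sr.
  move=> u /andP[su]; rewrite lt_min => /andP[ur uq] ut.
  rewrite qg ?su// rf ?su//; apply: le_trans (fs (ltW st)) _.
  rewrite lerD2r lez_nat card_fset_set_le//.
    apply: sub_finite_set fin => p [Up /andP[p0 pu] gp]; split=> //.
    by rewrite p0 (le_trans pu).
  move=> p [Up /andP[p0 ps] gp]; split=> //.
  by rewrite p0 (le_trans ps)// ltW.
- move=> s /andP[s0 st] fs _.
  have [|q /andP[q0 qs] gq] := path_left_lim (s := s) gx; first by rewrite s0.
  set y := left_lim g s in gq.
  have [r /andP[r0 rs] rf] := rsos_left_lim y fH LF s0.
  pose m := (Num.max q r + s) / 2.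
  have ms1 : Num.max q r < s by rewrite gt_max qs.
  have [mr mq ms] : [/\ r < m, q < m & m < s].
    have h : Num.max q r < m < s by apply/andP; split; rewrite /m; lra.
    by move: h; rewrite gt_max => /andP[/andP[]].
  have := fs m; rewrite ms (le_trans r0 (ltW mr)) => /(_ isT).
  move=> /(_ (le_trans (ltW ms) st)).
  rewrite gq ?mq ?ms// rf ?ms ?(ltW mr)// => le1.
  have fins : finite_set (path_updates U s g).
    apply: sub_finite_set fin => p [Up /andP[p0 pu] gp]; split=> //.
    by rewrite p0 (le_trans pu).
  have sub : path_updates U m g `<=` path_updates U s g.
    move=> p [Up /andP[p0 ps] gp]; split=> //.
    by rewrite p0 (le_trans ps)// ltW.
  have [Ug|nUg] := pselect (U (s, g s)); last first.
    have gsy : g s = y.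
      apply: contrapT => /(path_jump gx) []; first by rewrite s0.
      by move=> Us _; exact: nUg.
    rewrite gsy (rsos_no_update fH LF s0) -?gsy//.
    rewrite gsy; apply: le_trans le1 _.
    by rewrite lerD2r lez_nat card_fset_set_le.
  have lt1 : (#|` fset_set (path_updates U m g)| <
              #|` fset_set (path_updates U s g)|)%N.
    apply: (card_fset_set_lt (b := (s, g s))) => //.
      by split; rewrite //= s0 lexx.
    by move=> [_ /=]; rewrite leNgt ms andbF.
  (* The ring at [(s, g s)] adds one update, so an increment of 1 is allowed. *)
  suff fy : f s (g s) <= left_lim (f ^~ y) s + 1 by lia.
  have [->|neq] := eqVneq (g s) y.
    by rewrite (rsos_update y fH LF s0) lerD2l; case: (_ && _).
  have [|_ [n nn gn]] := path_jump gx (s := s) _ (fun e => elimN eqP neq e).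
    by rewrite s0.
  move: nn; rewrite inE => /orP[/eqP n0|nn].
    by move: neq; rewrite gn n0 addr0 eqxx.
  have yE : y = g s + - n by rewrite gn addrK.
  have nn' := nbrsN nn.
  rewrite yE; apply: (rsos_jump_le fH LF s0) => //.
  exact: (rsos_left_gradient _ HH fH LF).
Qed.

(** * Prolonging optimal paths *)

(** The path [g], followed up to time [r], waits at [g r] until time [u] and is
at [y] at time [u]. *)
Definition extend_path (R : realType) (d : nat) (g : R -> lattice d)
    (r u : R) (y : lattice d) : R -> lattice d :=
  fun v => if v <= r then g v else if v < u then g r else y.

Lemma extend_pathL (R : realType) (d : nat) (g : R -> lattice d) r u y v :
  v <= r -> extend_path g r u y v = g v.
Proof. by rewrite /extend_path => ->. Qed.

Lemma extend_pathM (R : realType) (d : nat) (g : R -> lattice d) r u y v :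
  r <= v < u -> extend_path g r u y v = g r.
Proof.
rewrite /extend_path => /andP[rv ->]; case: leP => // vr.
by congr g; apply/eqP; rewrite eq_le rv vr.
Qed.

Lemma extend_pathR (R : realType) (d : nat) (g : R -> lattice d) r u y :
  r < u -> extend_path g r u y u = y.
Proof. by move=> ru; rewrite /extend_path leNgt ru/= ltxx. Qed.

(** The first alternative prolongs a path that stays where it is, the second one
performs a jump (possibly with the zero step) at a ring of the new site. *)
Lemma lattice_path_extend (R : realType) (d : nat) (U : set (R * lattice d))
    (r u : R) (x y : lattice d) g :
  lattice_path U r x g -> 0 <= r < u ->
  y = x \/ U (u, y) /\ (exists2 n, n \in nbrs0 d & y = x + n) ->
  lattice_path U u y (extend_path g r u y).
Proof.
move=> gx /andP[r0 ru] xy; have grx := path_end gx.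
have left_eq v w : r < v <= u -> Num.max r w < v ->
    left_lim (extend_path g r u y) v = x.
  move=> /andP[rv vu] wv; apply: (left_limE rv) => z /andP[rz zv].
  by rewrite extend_pathM// (ltW rz) (lt_le_trans zv).
split.
- by rewrite extend_pathR.
- move=> s /andP[s0 su]; apply/near_at_rightP.
  have [rs|sr] := leP r s.
    exists u => // v /andP[sv vu].
    by rewrite !extend_pathM ?rs// vu (le_trans rs)// ltW.
  have /near_at_rightP[q sq qg] : right_continuous_at g s.
    by apply: (path_right_continuous gx); rewrite s0.
  exists (Num.min q r); first by rewrite lt_min sq.
  move=> v /andP[sv]; rewrite lt_min => /andP[vq vr].
  by rewrite (extend_pathL _ _ _ (ltW vr)) (extend_pathL _ _ _ (ltW sr)) qg ?sv.
- have [p pr pg] := path_piecewise_constant gx.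
  exists (rcons p u).
    rewrite -cats1; apply: itv_partition_cat pr _; exact: itv_partition1.
  have lp := itv_partition_nth_size 0 pr.
  have pr' i : (i <= size p)%N -> nth 0 (0 :: p) i <= r.
    move=> ip; rewrite (set_nth_default r)//.
    exact: (@itv_partition_nth_le _ _ 0 r p i _ pr).
  move=> i; rewrite size_rcons ltnS leq_eqVlt => /orP[/eqP ->{i}|ip] v w.
    rewrite -rcons_cons !nth_rcons/= ltnSn ltnn eqxx lp !in_itv/=.
    move=> /andP[rv vu] /andP[rw wu].
    by rewrite !extend_pathM ?vu ?wu ?(ltW rv) ?(ltW rw).
  rewrite -rcons_cons !nth_rcons/= (leqW ip) ltnS ip => vi wi.
  have le z : z \in `]nth 0 (0 :: p) i, nth 0 p i[ -> z <= r.
    rewrite in_itv/= => /andP[_ zp]; apply: le_trans (ltW zp) _.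
    exact: (pr' i.+1).
  by rewrite !extend_pathL ?le//; exact: (pg i).
- move=> s /andP[s0 su]; have [sr|rs] := leP s r.
    have -> : left_lim (extend_path g r u y) s = left_lim g s.
      by apply: eq_left_lim => v vs; rewrite extend_pathL// (le_trans vs).
    by rewrite extend_pathL//; apply: (path_jump gx); rewrite s0.
  rewrite (left_eq s r) ?rs ?maxxx//.
  move: su; rewrite le_eqVlt => /orP[/eqP ->|su].
    by rewrite extend_pathR//; case: xy.
  by rewrite extend_pathM ?su ?(ltW rs)// grx.
Qed.

Lemma extend_path_updates (R : realType) (d : nat) (U : set (R * lattice d))
    (r u : R) (y : lattice d) g :
  r < u -> (forall v, r < v < u -> ~ U (v, g r)) ->
  path_updates U u (extend_path g r u y) `<=`
  path_updates U r g `|` [set p | U p /\ p = (u, y)].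
Proof.
move=> ru noU [v z] [/= Up /andP[v0 vu]].
have [vr|rv] := leP v r.
  by rewrite extend_pathL// => gz; left; split; rewrite //= v0.
move: vu; rewrite le_eqVlt => /orP[/eqP vu|vu].
  by subst v; rewrite extend_pathR// => yz; right; rewrite yz.
rewrite extend_pathM ?(ltW rv)// => gz; exfalso.
by apply: (noU v); rewrite ?rv ?gz.
Qed.

(** The reverse inequality being [rsos_le_path_action], only this bound has to
be built up.  Finiteness of the weight is part of the definition so that the
bound can live in the integers. *)
Definition has_optimal_path (R : realType) (d : nat) (U : set (R * lattice d))
    (H : lattice d -> int) (f : R -> lattice d -> int) (t : R)
    (x : lattice d) :=
  exists g, [/\ lattice_path U t x g, finite_set (path_updates U t g) &
    (#|` fset_set (path_updates U t g)|)%:Z + H (g 0) <= f t x].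

Lemma has_optimal_path0 (R : realType) (d : nat) (U : set (R * lattice d))
    (H : lattice d -> int) (f : R -> lattice d -> int) x :
  rsos U H f -> has_optimal_path U H f 0 x.
Proof.
move=> fH; exists (cst x).
have -> : path_updates U 0 (cst x) = set0.
  rewrite -subset0 => p [_ /andP[p0 p0']].
  by have := lt_le_trans p0 p0'; rewrite ltxx.
split.
- split=> //.
  + by move=> s /andP[s0 /(le_lt_trans s0)]; rewrite ltxx.
  + by exists [::] => //; split.
  + by move=> s /andP[s0 /(lt_le_trans s0)]; rewrite ltxx.
- exact: finite_set0.
- by rewrite fset_set0 cardfs0 add0r (rsos_init fH).
Qed.

Lemma has_optimal_path_stay (R : realType) (d : nat) (U : set (R * lattice d))
    (H : lattice d -> int) (f : R -> lattice d -> int) (r s : R) x :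
  rsos U H f -> 0 <= r <= s -> (forall v, r < v <= s -> ~ U (v, x)) ->
  has_optimal_path U H f r x -> has_optimal_path U H f s x.
Proof.
move=> fH /andP[r0]; rewrite le_eqVlt => /orP[/eqP<-//|rs] noU.
move=> [g [gx gfin gle]]; have grx := path_end gx.
have sub : path_updates U s (extend_path g r s x) `<=` path_updates U r g.
  have noU' v : r < v < s -> ~ U (v, g r).
    by rewrite grx => /andP[rv vs]; apply: noU; rewrite rv ltW.
  move=> p /(extend_path_updates rs noU')[//|[Up pE]].
  by exfalso; apply: (noU s); rewrite ?rs ?lexx// -pE.
exists (extend_path g r s x); split.
- by apply: (lattice_path_extend gx); [rewrite r0|left].
- exact: sub_finite_set gfin.
- rewrite extend_pathL// (rsos_no_ring fH r0 (ltW rs) noU).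
  by apply: le_trans gle; rewrite lerD2r lez_nat card_fset_set_le.
Qed.

(** The step from [x] to [x + n] collects at most one new update, which is paid
for by the unit gained in height. *)
Lemma has_optimal_path_jump (R : realType) (d : nat) (U : set (R * lattice d))
    (H : lattice d -> int) (f : R -> lattice d -> int) (r u : R) x n :
  0 <= r < u -> (forall v, r < v < u -> ~ U (v, x)) ->
  U (u, x + n) -> n \in nbrs0 d -> f u (x + n) = f r x + 1 ->
  has_optimal_path U H f r x -> has_optimal_path U H f u (x + n).
Proof.
move=> /andP[r0 ru] noU Uu nn fE [g [gx gfin gle]]; have grx := path_end gx.
have sub : path_updates U u (extend_path g r u (x + n)) `<=`
    path_updates U r g `|` [set (u, x + n)].
  have noU' v : r < v < u -> ~ U (v, g r) by rewrite grx; exact: noU.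
  by move=> p /(extend_path_updates ru noU')[|[_ ->]]; [left|right].
have fin2 : finite_set (path_updates U r g `|` [set (u, x + n)]).
  by rewrite finite_setU; split=> //; exact: finite_set1.
exists (extend_path g r u (x + n)); split.
- by apply: (lattice_path_extend gx); [rewrite r0|right; split=> //; exists n].
- exact: sub_finite_set fin2.
- rewrite extend_pathL// fE.
  have : (#|` fset_set (path_updates U u (extend_path g r u (x + n)))| <=
          #|` fset_set (path_updates U r g)| + 1)%N.
    apply: leq_trans (card_fset_set_le fin2 sub) _.
    rewrite (fset_setU gfin (finite_set1 _)) fset_set1.
    by rewrite cardfsU cardfs1 leq_subr.
  by move: gle; lia.
Qed.

(** One backward step of an optimal path.  When the height of [x] does not grow
at [u], the failing indicator gives a strictly lower neighbour, and the bound
on gradients makes it lower by exactly 1. *)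
Lemma rsos_predecessor (R : realType) (d : nat) (U : set (R * lattice d))
    (H : lattice d -> int) f (u : R) x :
  (forall x n, n \in nbrs d -> `|H x - H (x + n)| <= 1) ->
  rsos U H f -> locally_finite U -> 0 < u -> U (u, x) ->
  exists2 n, n \in nbrs0 d & f u x = left_lim (f ^~ (x + n)) u + 1.
Proof.
move=> HH fH LF u0 Ux; rewrite (rsos_update x fH LF u0) asboolT//=.
have [_|/allPn[n nd lt]] := boolP (all _ _).
  by exists 0; rewrite ?inE ?eqxx// addr0.
exists n; first by rewrite inE nd orbT.
have := rsos_left_gradient x HH fH LF u0 nd.
by move: lt; rewrite -ltNge; lia.
Qed.

Lemma ltn_count (T : eqType) (p q : pred T) (s : seq T) (e : T) :
  subpred p q -> e \in s -> q e -> ~~ p e -> (count p s < count q s)%N.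
Proof.
move=> pq es qe npe; elim: s es => //= z s ih.
rewrite inE => /orP[/eqP<-|/ih lt].
  by rewrite qe (negbTE npe) add0n add1n ltnS sub_count.
by rewrite -addnS leq_add//; case: (p z) (pq z) => // ->.
Qed.

(** Optimal paths can be prolonged from time [a] to time [b] over a finite set
of sites that backward steps cannot leave.  All ring times of these sites up to
[b] form a finite list [T]; going back from [(s, x)] to a time before the
last ring of [x] removes at least that ring time from those that are at most
[s], so induction on their number terminates. *)
Lemma has_optimal_path_window (R : realType) (d : nat) (U : set (R * lattice d))
    (H : lattice d -> int) f (a b : R) (C : set (lattice d)) :
  (forall x n, n \in nbrs d -> `|H x - H (x + n)| <= 1) ->
  rsos U H f -> locally_finite U -> 0 <= a ->
  (forall x, has_optimal_path U H f a x) -> finite_set C ->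
  (forall x u n, C x -> a < u <= b -> U (u, x) -> n \in nbrs d -> C (x + n)) ->
  forall s x, a <= s <= b -> C x -> has_optimal_path U H f s x.
Proof.
move=> HH fH LF a0 opta finC closedC.
have /finite_seqP[T TE] :
    finite_set (\bigcup_(x in C) [set u | 0 < u <= b /\ U (u, x)]).
  by apply: bigcup_finite => // x _; exact: LF.
have inT u x : C x -> a < u <= b -> U (u, x) -> u \in T.
  move=> Cx /andP[au ub] Ux; have : [set` T] u.
    by rewrite -TE; exists x => //; split; rewrite // ub (le_lt_trans a0).
  by [].
suff main m s x : (count (fun e => (e <= s)%R) T < m)%N -> a <= s <= b -> C x ->
    has_optimal_path U H f s x.
  by move=> s x; exact: main (leqnn _).
elim: m s x => // m ih s x; rewrite ltnS => cm /andP[as_ sb] Cx.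
have [none|[u [/andP[au us] Ux] ulast]] := last_ring x s LF a0.
  by apply: (has_optimal_path_stay fH _ none); rewrite ?a0.
have u0 : 0 < u by exact: le_lt_trans au.
apply: (has_optimal_path_stay (r := u) fH _ ulast); first by rewrite ltW.
have ub : u <= b by exact: le_trans sb.
have [n nn fn] := rsos_predecessor HH fH LF u0 Ux.
have Cy : C (x + n).
  move: nn; rewrite inE => /orP[/eqP->|nn]; first by rewrite addr0.
  by apply: (closedC x u n) => //; rewrite au.
have [r1 /andP[r10 r1u] noU] := left_ring_free (x + n) LF u0.
have [r2 /andP[r20 r2u] r2f] := rsos_left_lim (x + n) fH LF u0.
(* From [r] on the height of [x + n] is its left limit at [u], and [x + n] does
   not ring before [u]; the ring at [u] is no longer counted at time [r]. *)
pose r := Num.max a (Num.max r1 r2).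
have ru : r < u by rewrite !gt_max au r1u.
have ar : a <= r by rewrite le_max lexx.
have r1r : r1 <= r by rewrite !le_max lexx orbT.
have r2r : r2 <= r by rewrite !le_max lexx !orbT.
have optr : has_optimal_path U H f r (x + n).
  apply: ih => //; last by rewrite ar (le_trans (ltW ru)).
  apply: leq_trans _ cm; apply: (@ltn_count _ _ _ _ u).
  - by move=> e /le_trans; apply; exact: le_trans (ltW ru) us.
  - by apply: (inT _ x); rewrite // au.
  - exact: us.
  - by rewrite -ltNge.
have -> : x = x + n + - n by rewrite addrK.
apply: (has_optimal_path_jump _ _ _ (nbrs0N nn) _ optr).
- by rewrite ru (le_trans a0).
- by move=> v /andP[rv vu]; apply: noU; rewrite vu (le_lt_trans r1r).
- by rewrite addrK.
- by rewrite addrK fn r2f// ru r2r.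
Qed.

(** * Finite clusters of ringing sites *)

Definition nbr_rel (d : nat) : rel (lattice d) := fun x y => y - x \in nbrs d.

(** An explicit list of all nearest-neighbour walks with [k] steps from [x] (the
starting point is left out), over which the union bound is taken. *)
Fixpoint walks (d : nat) (k : nat) (x : lattice d) : seq (seq (lattice d)) :=
  if k is k'.+1 then
    [seq x + n :: p | n <- nbrs d, p <- walks k' (x + n)]
  else [:: [::]].

Lemma mem_walks (d k : nat) (x : lattice d) (p : seq (lattice d)) :
  (p \in walks k x) = (size p == k) && path (@nbr_rel d) x p.
Proof.
elim: k x p => [|k ih] x p /=.
  by rewrite inE; case: p.
apply/allpairsPdep/idP => [[n [q [nd]]]|].
  rewrite ih => /andP[/eqP <- xq] ->.
  by rewrite /= eqxx/= xq andbT /nbr_rel addrAC subrr add0r.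
case: p => // y p /andP[]; rewrite eqSS /= => pk /andP[xy yp].
exists (y - x), p; split; rewrite ?ih ?subrKC ?pk//.
Qed.

Lemma size_nbrs (d : nat) : size (nbrs d) = (2 * d)%N.
Proof. by rewrite size_cat !size_map -!enumT size_enum_ord mul2n addnn. Qed.

Lemma size_walks (d k : nat) (x : lattice d) :
  size (walks k x) = ((2 * d) ^ k)%N.
Proof.
elim: k x => [//|k ih] x /=.
rewrite size_allpairs_dep (_ : map _ _ = nseq (size (nbrs d)) ((2 * d) ^ k)%N).
  by rewrite sumn_nseq size_nbrs mulnC -expnS.
by elim: (nbrs d) => //= n s ->; rewrite ih.
Qed.

(** The last site of the walk is exempt from [A]: this makes the cluster contain
the outer neighbours of its sites in [A], where a backward path may land. *)
Definition cluster (d : nat) (A : set (lattice d)) (x : lattice d) :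
    set (lattice d) :=
  [set y | exists p, [/\ path (@nbr_rel d) x p, last x p = y &
    forall z, z \in belast x p -> A z]].

Lemma cluster_closed (d : nat) (A : set (lattice d)) x y n :
  cluster A x y -> A y -> n \in nbrs d -> cluster A x (y + n).
Proof.
move=> [p [xp py pA]] Ay nd; exists (rcons p (y + n)); split.
- by rewrite rcons_path xp py /nbr_rel addrAC subrr add0r.
- by rewrite last_rcons.
- by move=> z; rewrite belast_rcons lastI py mem_rcons inE => /orP[/eqP->|/pA].
Qed.

(** Loop erasure turns any walk into a self-avoiding one with the same endpoints
whose other sites are still in [A], and such a walk has at most [K] steps. *)
Lemma finite_cluster (d K : nat) (A : set (lattice d)) (x : lattice d) :
  (forall p, p \in walks K x -> uniq (x :: p) ->
    exists2 y, y \in x :: p & ~ A y) ->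
  finite_set (cluster A x).
Proof.
move=> noA.
pose s := flatten [seq [seq last x p | p <- walks k x] | k <- iota 0 K.+1].
apply: (sub_finite_set (B := [set` s])); last exact: finite_seq.
move=> y [p0 [xp0 p0y pA]]; move: (p0y); case: (shortenP xp0) => p xp up sub py.
(* As [p] is self-avoiding, its last site does not occur earlier, so the earlier
   sites of [p] are among those of the original walk that lie in [A]. *)
have pA' z : z \in belast x p -> A z.
  move=> zp; have := up; rewrite lastI rcons_uniq py => /andP[yp _].
  have : z \in x :: p0.
    by move/mem_belast: zp; rewrite !inE => /orP[->//|/sub ->]; rewrite orbT.
  rewrite lastI p0y mem_rcons inE => /orP[/eqP zy|]; last exact: pA.
  by move: yp; rewrite -zy zp.
have pK : (size p <= K)%N.
  rewrite leqNgt; apply/negP => Kp.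
  have [||z] := noA (take K p).
  - by rewrite mem_walks size_take Kp eqxx take_path.
  - by rewrite -[x :: _]/(take K.+1 (x :: p)) take_uniq.
  move=> zp; apply; apply: pA'.
  move: zp; rewrite -[x :: _]/(take K.+1 (x :: p)) lastI -cats1 takel_cat.
    by move/mem_take.
  by rewrite size_belast.
apply/flattenP; exists [seq last x p | p <- walks (size p) x].
  by apply/mapP; exists (size p); rewrite ?mem_iota.
by apply/mapP; exists p; rewrite ?mem_walks ?eqxx.
Qed.

(** * The variational formula for a fixed realisation of the rings *)

(** The condition that rules out infinite backward paths: by [finite_cluster] it
confines those that end at [x] to finitely many sites during [`]a, b]]. *)
Definition no_long_ringing_walk (R : realType) (d : nat)
    (U : set (R * lattice d)) (a b : R) (x : lattice d) :=
  exists K, forall p, p \in walks K x -> uniq (x :: p) ->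
    exists2 y, y \in x :: p & forall u, a < u <= b -> ~ U (u, y).

(** Optimal paths pass from each window of length [delta] to the next one, the
cluster of the endpoint being the finite set of sites that they may visit. *)
Lemma has_optimal_path_everywhere (R : realType) (d : nat)
    (U : set (R * lattice d)) (H : lattice d -> int) f (delta : R) :
  (forall x n, n \in nbrs d -> `|H x - H (x + n)| <= 1) ->
  rsos U H f -> locally_finite U -> 0 < delta ->
  (forall (j : nat) x, no_long_ringing_walk U (delta *+ j) (delta *+ j.+1) x) ->
  forall t x, 0 <= t -> has_optimal_path U H f t x.
Proof.
move=> HH fH LF delta0 noL.
have step (j : nat) : (forall x, has_optimal_path U H f (delta *+ j) x) ->
    forall t x, delta *+ j <= t <= delta *+ j.+1 -> has_optimal_path U H f t x.
  move=> optj t x tj; have [K noLK] := noL j x.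
  pose A := [set y | exists2 u, delta *+ j < u <= delta *+ j.+1 & U (u, y)].
  apply: (has_optimal_path_window (C := cluster A x) HH fH LF _ optj _ _ tj).
  - by rewrite mulrn_wge0// ltW.
  - apply: (@finite_cluster _ K) => p pw up; have [y yp yU] := noLK p pw up.
    by exists y => // -[u uj /yU]; exact.
  - by move=> y u n Cy uj Uy; apply: cluster_closed Cy _; exists u.
  - by exists [::].
have grid (j : nat) : forall x, has_optimal_path U H f (delta *+ j) x.
  elim: j => [|j ih] x; first by rewrite mulr0n; exact: has_optimal_path0.
  by apply: (step j ih); rewrite lexx mulrS lerDr ltW.
move=> t x t0; apply: (step (Num.truncn (t / delta)) (grid _)).
have /andP[le lt] := truncn_itv (divr_ge0 t0 (ltW delta0)).
rewrite -[X in X <= _ <= _]mulr_natl -[X in _ <= _ <= X]mulr_natl.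
by rewrite -ler_pdivlMr// le/= -ler_pdivrMr// ltW.
Qed.

Lemma rsos_variational (R : realType) (d : nat) (U : set (R * lattice d))
    (H : lattice d -> int) f (delta : R) :
  (forall x n, n \in nbrs d -> `|H x - H (x + n)| <= 1) ->
  rsos U H f -> locally_finite U -> 0 < delta ->
  (forall (j : nat) x, no_long_ringing_walk U (delta *+ j) (delta *+ j.+1) x) ->
  forall t x, 0 <= t ->
  is_min
      [set (path_weight U t g + (H (g 0))%:~R%:E)%E
        | g in [set g : R -> lattice d | lattice_path U t x g]]
      ((f t x)%:~R%:E).
Proof.
move=> HH fH LF delta0 noL t x t0.
have low g : lattice_path U t x g ->
    ((f t x)%:~R%:E <= path_weight U t g + (H (g 0))%:~R%:E)%E.
  exact: rsos_le_path_action.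
split; last by move=> _ [g gx <-]; exact: low.
have [g [gx gfin gle]] := has_optimal_path_everywhere HH fH LF delta0 noL x t0.
exists g => //; apply/eqP; rewrite eq_le low// andbT.
rewrite /path_weight /counting asboolT// -EFinD lee_fin.
by rewrite -[(#|` _ |)%:R]mulrz_nat -intrD ler_int natz.
Qed.

(** * Almost sure properties of the rings *)

Definition site_window (R : realType) (d : nat) (a b : R) (x : lattice d) :
    set (R * lattice d) :=
  [set p | a < p.1 <= b /\ p.2 = x].

Lemma time_section_site_window (R : realType) (d : nat) (a b : R)
    (x y : lattice d) :
  time_section (site_window a b x) y =
  if y \in [set x] then `]a, b]%classic else set0.
Proof.
apply/seteqP; split => t.
  by move=> [/= tab ->]; rewrite mem_set//= in_itv.
case: ifPn => [/set_mem -> /=|_ []]; rewrite in_itv/= => tab.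
by split.
Qed.

Lemma spacetime_borel_site_window (R : realType) (d : nat) (a b : R)
    (x : lattice d) :
  spacetime_borel (site_window a b x).
Proof. by move=> y; rewrite time_section_site_window; case: ifPn. Qed.

Lemma intensity_site_window (R : realType) (d : nat) (a b : R) (x : lattice d) :
  0 <= a <= b -> intensity (site_window a b x) = (b - a)%:E.
Proof.
move=> /andP[a0 ab]; rewrite /intensity.
rewrite (eq_esum (b := fun y =>
  if y \in [set x] then (b - a)%:E else 0%E)); last first.
  move=> y _; rewrite time_section_site_window; case: ifPn => _; last first.
    by rewrite set0I measure0.
  rewrite (_ : _ `&` _ = `]a, b]%classic); last first.
    apply/setIidPl => t; rewrite /= !in_itv/= => /andP[at_ _].
    by rewrite andbT (le_trans a0)// ltW.
  rewrite lebesgue_measure_itv/= lte_fin; case: ltP => // ba.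
  by rewrite (_ : b = a) ?subrr//; apply/eqP; rewrite eq_le ab ba.
by rewrite -esum_mkcond esum_set1// lee_fin subr_ge0.
Qed.

Lemma measurable_preimage_num_points (R : realType) (disp : measure_display)
    (T : measurableType disp) (P : probability T R) (d : nat)
    (U : T -> set (R * lattice d)) (B : set (R * lattice d))
    (A : set (\bar R)) :
  poisson_clocks P U -> spacetime_borel B -> measurable A ->
  measurable (num_points U B @^-1` A).
Proof.
move=> PU BB mA; rewrite -[X in measurable X]setTI.
by apply: (clocks_measurable PU BB).
Qed.

Lemma prob_ring (R : realType) (disp : measure_display)
    (T : measurableType disp) (P : probability T R) (d : nat)
    (U : T -> set (R * lattice d)) (a b : R) (x : lattice d) :
  poisson_clocks P U -> 0 <= a <= b ->
  P (num_points U (site_window a b x) @^-1` ~` [set 0%E]) =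
  (1 - expR (- (b - a)))%:E.
Proof.
move=> PU ab; have Bx := spacetime_borel_site_window a b x.
rewrite -preimage_setC probability_setC; last first.
  exact: (measurable_preimage_num_points PU Bx (emeasurable_set1 _)).
have := clocks_poisson PU Bx (intensity_site_window x ab) 0%N.
by rewrite expr0 fact0 divr1 mul1r => ->.
Qed.

(** The event that all sites of [s] ring during [`]a, b]], expressed through
[num_points] because measurability is given for these counts. *)
Definition all_ring (R : realType) (T : Type) (d : nat)
    (U : T -> set (R * lattice d)) (a b : R) (s : seq (lattice d)) : set T :=
  [set w | forall y, y \in s -> num_points U (site_window a b y) w <> 0%E].

Lemma all_ringE (R : realType) (T : Type) (d : nat)
    (U : T -> set (R * lattice d)) (a b : R) (s : seq (lattice d)) :
  all_ring U a b s = \bigcap_(i in [set: 'I_(size s)])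
    (num_points U (site_window a b (nth 0 s i)) @^-1` ~` [set 0%E]).
Proof.
apply/seteqP; split => w.
  by move=> sw i _; apply: sw; rewrite mem_nth.
move=> sw y ys; have := sw (Ordinal (etrans (index_mem y s) ys)) I.
by rewrite /= nth_index.
Qed.

Lemma measurable_all_ring (R : realType) (disp : measure_display)
    (T : measurableType disp) (P : probability T R) (d : nat)
    (U : T -> set (R * lattice d)) (a b : R) (s : seq (lattice d)) :
  poisson_clocks P U -> measurable (all_ring U a b s).
Proof.
move=> PU; rewrite all_ringE; apply: fin_bigcap_measurable => // i _.
apply: (measurable_preimage_num_points PU (spacetime_borel_site_window _ _ _)).
by apply: measurableC; exact: emeasurable_set1.
Qed.

(** Distinct sites have disjoint windows, so their counts are independent, and
each is nonzero with probability [1 - expR (- (b - a)) <= b - a]. *)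
Lemma prob_all_ring (R : realType) (disp : measure_display)
    (T : measurableType disp) (P : probability T R) (d : nat)
    (U : T -> set (R * lattice d)) (a b : R) (s : seq (lattice d)) :
  poisson_clocks P U -> 0 <= a <= b -> uniq s ->
  (P (all_ring U a b s) <= ((b - a) ^+ size s)%:E)%E.
Proof.
move=> PU ab us; rewrite all_ringE.
have /andP[_ ab'] := ab.
rewrite (clocks_independent PU
  (B := fun i : 'I_(size s) => site_window a b (nth 0 s i))); first last.
- by move=> i; apply: measurableC; exact: emeasurable_set1.
- move=> i j _ _ [[u z] [/= [_ zi] [_ zj]]]; apply/val_inj/eqP.
  by rewrite -(nth_uniq 0 (ltn_ord i) (ltn_ord j) us) -zi -zj.
- by move=> i; exact: spacetime_borel_site_window.
under eq_bigr do rewrite prob_ring//.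
rewrite prodEFin lee_fin prodr_const card_ord.
have e1 : expR (- (b - a)) <= 1 by rewrite -expR0 ler_expR oppr_le0 subr_ge0.
apply: lerXn2r; rewrite ?nnegrE ?subr_ge0//.
by have := expR_ge1Dx (- (b - a)); lra.
Qed.

Lemma prob_union_bound (R : realType) (disp : measure_display)
    (T : measurableType disp) (P : probability T R) (I : Type) (s : seq I)
    (Q : pred I) (E : I -> set T) (c : R) : 0 <= c ->
  (forall i, measurable (E i)) -> (forall i, Q i -> (P (E i) <= c%:E)%E) ->
  (P (\big[setU/set0]_(i <- s | Q i) E i) <= ((size s)%:R * c)%:E)%E.
Proof.
move=> c0 mE PE; elim: s => [|i s ih]; first by rewrite big_nil measure0 mul0r.
rewrite big_cons /= mulrS mulrDl mul1r EFinD; case: ifPn => Qi.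
  apply: le_trans (measureU2 _ _ _) (leeD (PE i Qi) ih) => //.
  exact: bigsetU_measurable.
by rewrite -[X in (X <= _)%E]add0e; apply: leeD => //; rewrite lee_fin.
Qed.

Lemma num_points_neq0 (R : realType) (T : Type) (d : nat)
    (U : T -> set (R * lattice d)) (B : set (R * lattice d)) w p :
  U w p -> B p -> num_points U B w <> 0%E.
Proof.
move=> Up Bp; rewrite /num_points /counting; case: asboolP => // fin.
move=> [] /eqP; rewrite pnatr_eq0 cardfs_eq0 => /eqP /(fset_set_set0 fin) E.
have : (U w `&` B) p by split.
by rewrite E.
Qed.

(** The union bound over at most [(2 d) ^ K] self-avoiding walks, each visiting
[K + 1] sites, gives probability at most [(b - a) * 2 ^ -K] for every [K]. *)
Lemma ae_no_long_ringing_walk (R : realType) (disp : measure_display)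
    (T : measurableType disp) (P : probability T R) (d : nat)
    (U : T -> set (R * lattice d)) (a b : R) (x : lattice d) :
  poisson_clocks P U -> 0 <= a <= b -> (b - a) * (2 * d)%:R <= 2^-1 ->
  {ae P, forall w, no_long_ringing_walk (U w) a b x}.
Proof.
move=> PU ab small.
pose Bad K := \big[setU/set0]_(p <- walks K x | uniq (x :: p))
  all_ring U a b (x :: p).
have mBad K : measurable (Bad K).
  by apply: bigsetU_measurable => p _; exact: (measurable_all_ring _ _ _ PU).
have /andP[_ ba] := ab; rewrite -subr_ge0 in ba.
have PBad K : (P (Bad K) <= ((b - a) * 2^-1 ^+ K)%:E)%E.
  rewrite /Bad big_seq_cond.
  apply: le_trans (prob_union_bound _ (c := (b - a) ^+ K.+1) _ _ _) _.
  - by rewrite exprn_ge0.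
  - by move=> p; exact: (measurable_all_ring _ _ _ PU).
  - move=> p /andP[]; rewrite mem_walks => /andP[/eqP pK _] up.
    by rewrite -pK; exact: (prob_all_ring PU ab up).
  rewrite lee_fin size_walks natrX exprS mulrCA -exprMn ler_wpM2l//.
  by apply: lerXn2r; rewrite ?nnegrE ?mulr_ge0 ?invr_ge0 ?ler0n// mulrC.
apply: (negligibleS (A := \bigcap_K Bad K)).
  move=> w /= long K _; apply: contrapT => nB; apply: long; exists K => p pw up.
  apply: contrapT => no; apply: nB.
  rewrite /Bad -bigcup_seq_cond; exists p; first by apply/andP.
  move=> y yp; apply: contrapT => num0; apply: no; exists y => // u uab Uu.
  by apply: num0; apply: (num_points_neq0 Uu).
have mI : measurable (\bigcap_K Bad K) by exact: bigcapT_measurable.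
apply/negligibleP => //; apply/eqP; rewrite eq_le measure_ge0 andbT.
have finP := fin_num_measure P _ mI.
rewrite -(fineK finP) lee_fin leNgt; apply/negP => pos.
have cvg0 : (b - a) * 2^-1 ^+ K @[K --> \oo] --> (0 : R).
  rewrite -[X in _ --> X](mulr0 (b - a)); apply: cvgM; first exact: cvg_cst.
  by apply: cvg_expr; rewrite ger0_norm// invf_lt1// ltr1n.
have [K _ /(_ K (leqnn K))/= ltK] := cvgr_lt _ cvg0 _ pos.
have : (P (\bigcap_K Bad K) <= ((b - a) * 2^-1 ^+ K)%:E)%E.
  apply: le_trans (PBad K); apply: le_measure; [exact: mem_set|exact: mem_set|].
  by move=> w /(_ K I).
by rewrite -(fineK finP) lee_fin leNgt ltK.
Qed.

(** The weights of a Poisson law sum to 1, which leaves no mass for an infinite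
count. *)
Lemma ae_finite_num_points (R : realType) (disp : measure_display)
    (T : measurableType disp) (P : probability T R) (d : nat)
    (U : T -> set (R * lattice d)) (B : set (R * lattice d)) (lambda : R) :
  poisson_clocks P U -> spacetime_borel B ->
  intensity B = lambda%:E -> 0 < lambda ->
  {ae P, forall w, finite_set (U w `&` B)}.
Proof.
move=> PU BB Bl l0.
pose F k := num_points U B @^-1` [set k%:R%:E].
have mF k : measurable (F k).
  exact: (measurable_preimage_num_points PU BB (emeasurable_set1 _)).
have mFU : measurable (\bigcup_k F k) by exact: bigcupT_measurable.
have tF : trivIset setT F.
  move=> i j _ _ [w [Fi Fj]]; have : i%:R%:E = j%:R%:E :> \bar R by rewrite -Fi.
  by move=> [/eqP]; rewrite eqr_nat => /eqP.
have PF : P (\bigcup_k F k) = 1%E.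
  have : poisson_prob lambda 0 [set: nat] = 1%E by exact: probability_setT.
  rewrite measure_semi_bigcup// /poisson_prob l0 => <-.
  rewrite -nneseries_esumT; last first.
    by move=> n; rewrite lee_fin; exact: poisson_pmf_ge0.
  apply: eq_eseriesr => k _; apply: etrans (clocks_poisson PU BB Bl k) _.
  by rewrite /poisson_pmf l0.
exists (~` \bigcup_k F k); split; first exact: measurableC.
  by rewrite probability_setC// PF subee.
move=> w /= nfin [k _]; rewrite /F /num_points /= /counting.
by rewrite asboolF.
Qed.

Lemma ae_forall_countType (R : realType) (disp : measure_display)
    (T : measurableType disp) (P : probability T R) (I : countType)
    (Q : I -> T -> Prop) :
  (forall i, {ae P, forall w, Q i w}) -> {ae P, forall w, forall i, Q i w}.
Proof.
move=> PQ.
have : {ae P, forall w, forall n : nat,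
    if choice.unpickle n is Some i then Q i w else True}.
  apply: ae_foralln => n; case: choice.unpickle => [i|]; first exact: PQ.
  exact: aeW.
apply: filterS => w Qw i.
by have := Qw (choice.pickle i); rewrite choice.pickleK.
Qed.

Lemma ae_locally_finite (R : realType) (disp : measure_display)
    (T : measurableType disp) (P : probability T R) (d : nat)
    (U : T -> set (R * lattice d)) :
  poisson_clocks P U -> {ae P, forall w, locally_finite (U w)}.
Proof.
move=> PU.
have : {ae P, forall w, forall x (n : nat),
    finite_set (U w `&` site_window 0 n.+1%:R x)}.
  apply: ae_forall_countType => x; apply: ae_foralln => n.
  apply: (ae_finite_num_points PU (spacetime_borel_site_window _ _ _)).
    by rewrite intensity_site_window ?lexx//=; exact: ler0n.
  by rewrite subr0 ltr0n.
apply: filterS => w fin x b.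
apply: (sub_finite_set
  (B := fst @` (U w `&` site_window 0 (Num.truncn b).+1%:R x))).
  move=> s [/andP[s0 sb] Us]; exists (s, x) => //; split=> //; split=> //=.
  by rewrite s0 ltW// (le_lt_trans sb)// truncnS_gt.
exact: finite_image.
Qed.

Theorem proposition3p5 (R : realType) (disp : measure_display)
    (T : measurableType disp) (P : probability T R)
    (d : nat) (d_ge1 : (1 <= d)%N)
    (U : T -> set (R * lattice d)) (clocksU : poisson_clocks P U)
    (H : lattice d -> int)
    (H_rsos : forall x n, n \in nbrs d -> `|H x - H (x + n)| <= 1)
    (f : T -> R -> lattice d -> int)
    (f_rsos : {ae P, forall w, rsos (U w) H (f w)}) :
  {ae P, forall w, forall (t : R) (x : lattice d), 0 <= t ->
    is_min
      [set (path_weight (U w) t g + (H (g 0))%:~R%:E)%E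
        | g in [set g : R -> lattice d | lattice_path (U w) t x g]]
      ((f w t x)%:~R%:E)}.
Proof.
pose delta : R := (2 * (2 * d)%:R)^-1.
have d0 : (0 : R) < (2 * d)%:R by rewrite ltr0n muln_gt0.
have delta0 : 0 < delta by rewrite invr_gt0 mulr_gt0.
(* This choice of [delta] gives [2 d delta = 1/2]. *)
have : {ae P, forall w, forall x (j : nat),
    no_long_ringing_walk (U w) (delta *+ j) (delta *+ j.+1) x}.
  apply: ae_forall_countType => x; apply: ae_foralln => j.
  apply: (ae_no_long_ringing_walk _ clocksU); rewrite mulrS.
    by rewrite lerDr (ltW delta0) andbT mulrn_wge0// ltW.
  by rewrite addrK /delta invfM -mulrA mulVf ?mulr1// gt_eqF.
have := ae_locally_finite clocksU.
move: f_rsos; apply: filterS3 => w fH LF noL.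
exact: (rsos_variational H_rsos fH LF delta0 (fun j x => noL x j)).
Qed.
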